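(* Let $p\in[0,1]$ and let $A_0=\sqrt{1-p}\,I$, $A_1=\sqrt{p/3}\,\sigma_x$, $A_2=\sqrt{p/3}\,\sigma_y$, $A_3=\sqrt{p/3}\,\sigma_z$ in $\mathbb{M}_2(\mathbb{C})$. The sequence of states $\{\varphi_n\}_{n\ge1}$ associated with the depolarizing matrix product state defined by $\{A_k\}_{k=0}^3$ converges in the weak-* topology to a limiting state $\varphi$ on $\mathcal{B}_{\mathbb{N}}=\bigotimes_{n\in\mathbb{N}}\mathcal{B}(\mathbb{C}^4)$, which is given on local observables by $$\varphi(X)=\frac12\sum_{\substack{i_1,\dots,i_N\\ j_1,\dots,j_N}}\langle i_1,\dots,i_N|X|j_1,\dots,j_N\rangle\,\operatorname{Tr}\big(A_{i_N}^\dagger\cdots A_{i_1}^\dagger A_{j_1}\cdots A_{j_N}\big)$$ for all $N\in\mathbb{N}$ and all $X\in\mathcal{B}_{[1,N]}$, where all indices run over $\{0,1,2,3\}$.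
   Context: $I$ is the $2\times2$ identity and $\sigma_x=\begin{pmatrix}0&1\\1&0\end{pmatrix}$, $\sigma_y=\begin{pmatrix}0&-i\\i&0\end{pmatrix}$, $\sigma_z=\begin{pmatrix}1&0\\0&-1\end{pmatrix}$ are the Pauli matrices; $\operatorname{Tr}$ is the usual unnormalized trace. $\{|i\rangle\}_{i=0}^3$ is the standard basis of $\mathbb{C}^4$. $\mathcal{B}_{[1,n]}=\mathcal{B}(\mathbb{C}^4)^{\otimes n}$, embedded in $\mathcal{B}_{[1,n+1]}$ by $X\mapsto X\otimes\mathbf{1}_{n+1}$; $\mathcal{B}_{\mathbb{N}}$ is the infinite tensor product C$^*$-algebra, i.e. the norm closure of $\bigcup_n\mathcal{B}_{[1,n]}$. A state is a normalized positive linear functional. The depolarizing matrix product vectors are $|\Psi_n\rangle=\sum_{i_1,\dots,i_n=0}^3\operatorname{Tr}(A_{i_1}\cdots A_{i_n})|i_1,\dots,i_n\rangle\in(\mathbb{C}^4)^{\otimes n}$, and the associated states are $$\varphi_n(X)=\frac{\langle\Psi_{n+1}|X\otimes\mathbf{1}_{n+1}|\Psi_{n+1}\rangle}{\langle\Psi_{n+1}|\Psi_{n+1}\rangle},\qquad X\in\mathcal{B}_{[1,n]},\ n\ge1.$$ Since $\varphi_n$ is defined on $\mathcal{B}_{[1,n]}$, weak-* convergence to $\varphi$ means that $\lim_{n\to\infty}\varphi_n(X\otimes\mathbf{1}_{[N+1,n]})=\varphi(X)$ for every $N$ and every $X\in\mathcal{B}_{[1,N]}$. *)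

(* Defs.v *)
From mathcomp Require Import all_boot all_order all_algebra complex.
From mathcomp Require Import all_classical all_reals all_analysis.

Set Implicit Arguments.
Unset Strict Implicit.
Unset Printing Implicit Defensive.

Import Order.TTheory GRing.Theory Num.Theory.
Import numFieldNormedType.Exports.

Local Open Scope complex_scope.
Local Open Scope classical_set_scope.
Local Open Scope ring_scope.

Definition adjmx (R : realType) m n (X : 'M[R[i]]_(m, n)) : 'M[R[i]]_(n, m) :=
  (map_mx Num.conj X)^T.

Definition state_on (R : realType) (V : lmodType R[i]) (one : V)
    (mul : V -> V -> V) (star : V -> V) (f : V -> R[i]) : Prop :=
  [/\ scalar f, (forall x, 0 <= f (mul (star x) x)) & f one = 1].

Definition mx_state (R : realType) d (f : 'M[R[i]]_d -> R[i]) : Prop :=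
  state_on 1%:M mulmx (@adjmx R d d) f.

(* Unital C*-algebras over R[i]. The algebra operations are laid on top of a
   completeNormedModType by a plain record, because the ring and normed-module
   structures have no common join in the hierarchy. As everywhere in that
   hierarchy, the norm takes values in the nonnegative elements of R[i]. *)
Record cstarAlgebra (R : realType) := CStarAlgebra {
  cs_car :> completeNormedModType R[i];
  cs_one : cs_car;
  cs_mul : cs_car -> cs_car -> cs_car;
  cs_star : cs_car -> cs_car;
  cs_mulA : associative cs_mul;
  cs_mul1l : left_id cs_one cs_mul;
  cs_mul1r : right_id cs_one cs_mul;
  cs_mulDl : left_distributive cs_mul +%R;
  cs_mulDr : right_distributive cs_mul +%R;
  cs_mulZl : forall (a : R[i]) x y, cs_mul (a *: x) y = a *: cs_mul x y;
  cs_mulZr : forall (a : R[i]) x y, cs_mul x (a *: y) = a *: cs_mul x y;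
  cs_starD : {morph cs_star : x y / x + y};
  cs_starZ : forall (a : R[i]) x, cs_star (a *: x) = Num.conj a *: cs_star x;
  cs_starM : forall x y, cs_star (cs_mul x y) = cs_mul (cs_star y) (cs_star x);
  cs_starK : involutive cs_star;
  cs_normM : forall x y, `|cs_mul x y| <= `|x| * `|y|;
  cs_normC : forall x, `|cs_mul (cs_star x) x| = `|x| ^+ 2
}.

Definition cstar_state (R : realType) (B : cstarAlgebra R) (f : B -> R[i]) :
  Prop := state_on (cs_one B) (@cs_mul R B) (@cs_star R B) f.

(* Basis labels i_1, ..., i_n of (C^4)^{(x) n}; the matrix entry
   <i|X|j> of an observable is mxent X i j. *)
Notation cfg n := {ffun 'I_n -> 'I_4}.

Definition obs (R : realType) n := 'M[R[i]]_#|{: cfg n}|.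

Definition mxent (R : realType) n (X : obs R n) (i j : cfg n) : R[i] :=
  X (enum_rank i) (enum_rank j).

Definition cfgl N m (i : cfg (N + m)) : cfg N := [ffun k => i (lshift m k)].
Definition cfgr N m (i : cfg (N + m)) : cfg m := [ffun k => i (rshift N k)].

(* X (x) 1_[N+1, N+m] *)
Definition obs_ext (R : realType) N m (X : obs R N) : obs R (N + m) :=
  \matrix_(a, b)
    (mxent X (cfgl (enum_val a)) (cfgl (enum_val b)) *+
     (cfgr (enum_val a) == cfgr (enum_val b))).

(* The infinite tensor product is determined, up to a unique *-isomorphism
   compatible with the embeddings, as a unital C*-algebra containing the
   B_[1,n] as an increasing union of unital *-subalgebras with dense union. *)
Record quasilocal (R : realType) (B : cstarAlgebra R)
    (iota : forall n, obs R n -> B) : Prop := Quasilocal {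
  ql_linear : forall n, linear (iota n);
  ql_one : forall n, iota n 1%:M = cs_one B;
  ql_mul : forall n (X Y : obs R n),
    iota n (X *m Y) = cs_mul (iota n X) (iota n Y);
  ql_star : forall n (X : obs R n), iota n (adjmx X) = cs_star (iota n X);
  ql_inj : forall n, injective (iota n);
  ql_ext : forall n (X : obs R n), iota (n + 1)%N (obs_ext 1 X) = iota n X;
  ql_dense : closure (\bigcup_n range (iota n)) = [set: B]
}.

Section MatrixProduct.
Variables (R : realType) (A : 'I_4 -> 'M[R[i]]_2).

(* A_{i_1} ... A_{i_n}: \prod multiplies in increasing order of k. *)
Definition mpsprod n (i : cfg n) : 'M[R[i]]_2 := \prod_(k < n) A (i k).

(* A_{i_n}^* ... A_{i_1}^* *)
Definition mpsprod_adj n (i : cfg n) : 'M[R[i]]_2 :=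
  \prod_(k < n) adjmx (A (i (rev_ord k))).

Definition mpv n : 'cV[R[i]]_#|{: cfg n} | :=
  \col_a \tr (mpsprod (enum_val a)).

Definition mpstate n (X : obs R n) : R[i] :=
  (adjmx (mpv (n + 1)) *m obs_ext 1 X *m mpv (n + 1)) 0 0 /
  (adjmx (mpv (n + 1)) *m mpv (n + 1)) 0 0.

End MatrixProduct.

Definition sigma_x (R : realType) : 'M[R[i]]_2 :=
  \matrix_(a, b) (a != b)%:R.
Definition sigma_y (R : realType) : 'M[R[i]]_2 :=
  \matrix_(a, b) (if a == b then 0 else if a == 0 then 0 -i* 1 else 0 +i* 1).
Definition sigma_z (R : realType) : 'M[R[i]]_2 :=
  \matrix_(a, b) (if a != b then 0 else if a == 0 then 1 else -1).

Definition depolA (R : realType) (p : R) (k : 'I_4) : 'M[R[i]]_2 :=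
  match val k with
  | 0%N => (Num.sqrt (1 - p))%:C *: 1%:M
  | 1%N => (Num.sqrt (p / 3))%:C *: sigma_x R
  | 2%N => (Num.sqrt (p / 3))%:C *: sigma_y R
  | _ => (Num.sqrt (p / 3))%:C *: sigma_z R
  end.

(* Main.v *)
(* The transfer matrix of the depolarizing MPS has the eigenvalue 1 once and
   lambda = 1 - 4p/3 three times. By the Pauli completeness relation, summing
   conj(Tr(P A_k)) Tr(Q A_k) over the words k of length L gives
     lambda^L conj(Tr P) Tr Q + (1 - lambda^L)/2 Tr(P^* Q),
   so <Psi_n|Psi_n> = 1 + 3 lambda^n (nonzero for n >= 2) and phi_n converges on
   local observables when |lambda| < 1; for p = 0 all A_k are scalar and the
   sequence is constant. The limit functionals f are states on matrix algebras,
   compatible with the embeddings. The Cauchy-Schwarz inequality iterated along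
   Y_(k+1) = Y_k^* Y_k gives |f X|^(2^k) <= K |iota X|^(2^k), with K from
   a comparison of norms on the matrix algebra, hence |f X| <= |iota X|, and f
   extends by density to a state of the quasilocal algebra. *)
Require Import Defs.
From mathcomp Require Import all_boot all_order all_algebra complex.
From mathcomp Require Import all_classical all_reals all_analysis.
From mathcomp Require Import ring lra.

Set Implicit Arguments.
Unset Strict Implicit.
Unset Printing Implicit Defensive.

Import Order.TTheory GRing.Theory Num.Theory.
Import numFieldNormedType.Exports.

Local Open Scope complex_scope.
Local Open Scope classical_set_scope.
Local Open Scope ring_scope.

(** * Conjugate transposes of complex matrices *)

Section Adjoint.
Variable R : realType.
Local Notation C := R[i].

Lemma adjmxE m n (X : 'M[C]_(m, n)) i j : adjmx X i j = Num.conj (X j i).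
Proof. by rewrite !mxE. Qed.

Lemma adjmxD m n : {morph @adjmx R m n : X Y / X + Y}.
Proof. by move=> X Y; apply/matrixP => i j; rewrite !mxE rmorphD. Qed.

Lemma adjmxZ m n a (X : 'M[C]_(m, n)) :
  adjmx (a *: X) = Num.conj a *: adjmx X.
Proof. by apply/matrixP => i j; rewrite !mxE rmorphM. Qed.

Lemma adjmxM m n q (X : 'M[C]_(m, n)) (Y : 'M[C]_(n, q)) :
  adjmx (X *m Y) = adjmx Y *m adjmx X.
Proof. by rewrite /adjmx map_mxM trmx_mul. Qed.

Lemma adjmx1 n : adjmx 1%:M = 1%:M :> 'M[C]_n.
Proof. by rewrite /adjmx map_scalar_mx rmorph1 tr_scalar_mx. Qed.

Lemma mxtrace_adjM_ge0 m n (X : 'M[C]_(m, n)) : 0 <= \tr (adjmx X *m X).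
Proof.
apply: sumr_ge0 => i _; rewrite mxE; apply: sumr_ge0 => j _.
by rewrite adjmxE mulrC mul_conjC_ge0.
Qed.

(** The adjoint reverses products, so the last factor on one side is matched with the first on the
    other. *)
Lemma adjmx_prod d n (F : 'I_n -> 'M[C]_d) :
  adjmx (\prod_(k < n) F k) = \prod_(k < n) adjmx (F (rev_ord k)).
Proof.
elim: n F => [|n IH] F; first by rewrite !big_ord0 adjmx1.
rewrite big_ord_recr big_ord_recl /= adjmxM IH; congr (adjmx (F _) *m _).
  by apply: val_inj; rewrite /= subn1.
apply: eq_bigr => k _; congr (adjmx (F _)); apply: val_inj => /=.
by rewrite !subSS.
Qed.

Lemma mpsprod_adjE (A : 'I_4 -> 'M[C]_2) n (i : cfg n) :
  mpsprod_adj A i = adjmx (mpsprod A i).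
Proof. by rewrite adjmx_prod. Qed.

End Adjoint.

(** * Splitting configurations of N + m sites; matrix entries of observables *)

Section Configurations.
Variable R : realType.
Local Notation C := R[i].

Definition cfgcat N m (u : cfg N * cfg m) : cfg (N + m) :=
  [ffun k => match fintype.split k with inl a => u.1 a | inr b => u.2 b end].

Lemma cfgcatK N m : cancel (@cfgcat N m) (fun i => (cfgl i, cfgr i)).
Proof.
case=> i j; congr pair; apply/ffunP => k; rewrite !ffunE.
  by case: split_ordP => [a /lshift_inj <-|b /eqP]; rewrite ?eq_lrshift.
by case: split_ordP => [a /eqP|b /rshift_inj <-]; rewrite ?eq_rlshift.
Qed.

Lemma cfglrK N m : cancel (fun i => (cfgl i, cfgr i)) (@cfgcat N m).
Proof.
by move=> i; apply/ffunP => k; rewrite !ffunE; case: split_ordP => ? ->; rewrite ffunE.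
Qed.

Lemma sum_cfgD N m (V : nmodType) (F : cfg (N + m) -> V) :
  \sum_i F i = \sum_(i : cfg N) \sum_(j : cfg m) F (cfgcat (i, j)).
Proof.
rewrite pair_big (reindex (@cfgcat N m)) /=; first by apply: eq_bigr => -[].
exists (fun i => (cfgl i, cfgr i)) => i _; [exact: cfgcatK|exact: cfglrK].
Qed.

Lemma sum_cfg1 (V : nmodType) (F : cfg 1 -> V) :
  \sum_i F i = \sum_(a : 'I_4) F [ffun=> a].
Proof.
rewrite (reindex (fun a : 'I_4 => [ffun=> a] : cfg 1)) //=.
exists (fun i : cfg 1 => i ord0) => i _ /=; first by rewrite ffunE.
by apply/ffunP => k; rewrite ffunE (ord1 k).
Qed.

Lemma sum_cfg0 (V : nmodType) (F : cfg 0 -> V) (c : V) :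
  (forall i, F i = c) -> \sum_i F i = c.
Proof.
move=> Fc; rewrite (bigD1 [ffun k : 'I_0 => ord0]) //= Fc big1 ?addr0 // => i /eqP[].
by apply/ffunP => -[].
Qed.

Lemma sum_enum_val n (V : nmodType) (F : 'I_#|{: cfg n}| -> V) :
  \sum_a F a = \sum_(i : cfg n) F (enum_rank i).
Proof. by rewrite (reindex enum_rank) //; apply/onW_bij/enum_rank_bij. Qed.

Lemma mxent_obs_ext N m (X : obs R N) (i j : cfg N) (k l : cfg m) :
  mxent (obs_ext m X) (cfgcat (i, k)) (cfgcat (j, l)) =
  mxent X i j *+ (k == l).
Proof.
rewrite /mxent mxE !enum_rankK.
by case: (cfgcatK (i, k)) (cfgcatK (j, l)) => -> -> [-> ->].
Qed.

Lemma mxent_mul n (X Y : obs R n) (i j : cfg n) :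
  mxent (X *m Y) i j = \sum_k mxent X i k * mxent Y k j.
Proof. by rewrite /mxent mxE sum_enum_val. Qed.

Lemma mxent_adj n (X : obs R n) (i j : cfg n) :
  mxent (adjmx X) i j = Num.conj (mxent X j i).
Proof. exact: adjmxE. Qed.

Lemma mxent1 n (i j : cfg n) : mxent (1%:M : obs R n) i j = (i == j)%:R.
Proof. by rewrite /mxent mxE (inj_eq enum_rank_inj). Qed.

Lemma mxentP n (X Y : obs R n) : (forall i j, mxent X i j = mxent Y i j) -> X = Y.
Proof.
by move=> XY; apply/matrixP => a b; rewrite -(enum_valK a) -(enum_valK b); exact: XY.
Qed.

(** The identity on the last m sites is a Kronecker delta, so of the two sums over right halves only
    the diagonal survives. *)
Lemma sum_obs_ext N m (X : obs R N) (F : cfg (N + m) -> cfg (N + m) -> C) :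
  \sum_i \sum_j mxent (obs_ext m X) i j * F i j =
  \sum_(i : cfg N) \sum_(j : cfg N) mxent X i j *
    \sum_(k : cfg m) F (cfgcat (i, k)) (cfgcat (j, k)).
Proof.
rewrite sum_cfgD; apply: eq_bigr => i _.
transitivity (\sum_(k : cfg m) \sum_(j : cfg N)
    mxent X i j * F (cfgcat (i, k)) (cfgcat (j, k))).
  apply: eq_bigr => k _; rewrite sum_cfgD; apply: eq_bigr => j _.
  rewrite (bigD1 k) //= mxent_obs_ext eqxx big1 ?addr0 // => l /negPf kl.
  by rewrite mxent_obs_ext eq_sym kl mul0r.
by rewrite exchange_big; apply: eq_bigr => j _; rewrite mulr_sumr.
Qed.

Lemma mpsprodD (A : 'I_4 -> 'M[C]_2) N m (i : cfg N) (j : cfg m) :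
  mpsprod A (cfgcat (i, j)) = mpsprod A i *m mpsprod A j.
Proof.
case: (cfgcatK (i, j)) => iE jE; rewrite /mpsprod big_split_ord /=; congr (_ *m _).
  by apply: eq_bigr => k _; rewrite -[in RHS]iE [in RHS]ffunE.
by apply: eq_bigr => k _; rewrite -[in RHS]jE [in RHS]ffunE.
Qed.

Lemma obs_ext1 N m : obs_ext m (1%:M : obs R N) = 1%:M.
Proof.
apply: mxentP => i j; rewrite -(cfglrK i) -(cfglrK j).
rewrite mxent_obs_ext !mxent1 (can_eq (@cfgcatK N m)) xpair_eqE.
by case: eqP => _; case: eqP => _.
Qed.

Lemma obs_extM N m (X Y : obs R N) :
  obs_ext m (X *m Y) = obs_ext m X *m obs_ext m Y.
Proof.
apply: mxentP => i j; rewrite -(cfglrK i) -(cfglrK j).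
rewrite mxent_obs_ext !mxent_mul sum_cfgD -sumrMnl; apply: eq_bigr => a _.
rewrite (bigD1 (cfgr i)) //= big1 => [|l /negPf li]; last first.
  by rewrite mxent_obs_ext eq_sym li mul0r.
by rewrite !mxent_obs_ext eqxx addr0 mulrnAr.
Qed.

Lemma obs_ext_adj N m (X : obs R N) :
  obs_ext m (adjmx X) = adjmx (obs_ext m X).
Proof.
apply: mxentP => i j; rewrite -(cfglrK i) -(cfglrK j).
by rewrite mxent_adj !mxent_obs_ext mxent_adj rmorphMn eq_sym.
Qed.

Lemma obs_ext_linear N m : linear (@obs_ext R N m).
Proof.
by move=> a X Y; apply/matrixP => i j; rewrite !mxE /mxent !mxE mulrnDl mulrnAr.
Qed.

End Configurations.

(** * Transfer identities of the depolarizing family and the limit functional *)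

Section Depolarizing.
Variables (R : realType) (p : R).
Hypothesis hp : 0 <= p <= 1.
Local Notation C := R[i].
Local Notation A := (depolA p).

(** Eigenvalue (1 - p) + p/3 - 2p/3 of the map X -> sum_a A_a X A_a^* on the Pauli matrices: each
    commutes with itself and anticommutes with the other two. *)
Definition depol_eig : R := 1 - 4 * p / 3.
Local Notation lam := depol_eig%:C.

Lemma sum_depol (V : nmodType) (F : 'M[C]_2 -> V) :
  \sum_(a : 'I_4) F (A a) =
    F ((Num.sqrt (1 - p))%:C *: 1%:M) + F ((Num.sqrt (p / 3))%:C *: sigma_x R)
  + F ((Num.sqrt (p / 3))%:C *: sigma_y R)
  + F ((Num.sqrt (p / 3))%:C *: sigma_z R).
Proof. by rewrite !big_ord_recr big_ord0 /= add0r. Qed.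

Lemma conj_realC (x : R) : Num.conj x%:C = x%:C.
Proof. by rewrite conj_Creal //; apply/complex_realP; exists x. Qed.

Lemma sqr_sqrt1p : (Num.sqrt (1 - p))%:C ^+ 2 = (1 - p)%:C.
Proof. by rewrite -rmorphXn /= sqr_sqrtr // subr_ge0; case/andP: hp. Qed.

Lemma sqr_sqrtp3 : (Num.sqrt (p / 3))%:C ^+ 2 = (p / 3)%:C.
Proof. by rewrite -rmorphXn /= sqr_sqrtr // divr_ge0 //; case/andP: hp. Qed.

Lemma depol_eigE : lam = 1 - 4 * p%:C / 3.
Proof. by rewrite /depol_eig rmorphB rmorph1 fmorph_div rmorphM !rmorph_nat. Qed.

Lemma mxtraceM2 (X Y : 'M[C]_2) :
  \tr (X *m Y) = X 0 0 * Y 0 0 + X 0 1 * Y 1 0 + (X 1 0 * Y 0 1 + X 1 1 * Y 1 1).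
Proof.
have liftE : lift ord0 ord0 = 1 :> 'I_2 by apply: val_inj.
by rewrite /mxtrace !big_ord_recl !big_ord0 !mxE !big_ord_recl !big_ord0 /=
  !addr0 liftE.
Qed.

(** With s running over I and the Pauli matrices, the products conj(Tr(P s)) Tr(Q s) sum to 2 Tr(P^*
    Q). The weights 1 - p and p/3 then give the coefficients (1 - p) - p/3 = lam and 2p/3 = (1 -
    lam)/2. *)
Lemma depol_overlap1 (P Q : 'M[C]_2) :
  \sum_(a : 'I_4) Num.conj (\tr (P *m A a)) * \tr (Q *m A a) =
  lam * (Num.conj (\tr P) * \tr Q) + (1 - lam) / 2 * \tr (adjmx P *m Q).
Proof.
pose g Y := Num.conj (\tr (P *m Y)) * \tr (Q *m Y).
have gZ (x : R) Y : g (x%:C *: Y) = x%:C ^+ 2 * g Y.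
  by rewrite /g -!scalemxAr !mxtraceZ rmorphM /= conj_realC mulrACA expr2.
rewrite (sum_depol g) !gZ sqr_sqrt1p sqr_sqrtp3 /g !mulmx1.
have Ni : (0 -i* 1 : C) = - 'i by apply/eqP; rewrite eq_complex /= oppr0 !eqxx.
(* The two factors i coming from [sigma_y] cancel here, which leaves an identity free of i for
   [field]. *)
have ii (x y z w : C) : Num.conj (x * 'i + y * - 'i) * (z * 'i + w * - 'i) =
    Num.conj (x - y) * (z - w).
  rewrite !mulrN -!mulrBl rmorphM /= [Num.conj 'i]conjCi mulrACA.
  by rewrite mulNr -expr2 sqrCi opprK mulr1.
rewrite !mxtraceM2 !adjmxE !mxE /= Ni ?(mulr0, mulr1, addr0, add0r) ii.
rewrite /mxtrace !big_ord_recl !big_ord0 /= !addr0.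
have -> : lift ord0 ord0 = 1 :> 'I_2 by apply: val_inj.
rewrite depol_eigE !rmorphD !rmorphN /= rmorph1 fmorph_div rmorph_nat.
by field.
Qed.

Lemma sigma_unitary :
  [/\ sigma_x R *m adjmx (sigma_x R) = 1%:M,
      sigma_y R *m adjmx (sigma_y R) = 1%:M
    & sigma_z R *m adjmx (sigma_z R) = 1%:M].
Proof.
have Ni : (0 -i* 1 : C) = - 'i by apply/eqP; rewrite eq_complex /= oppr0 !eqxx.
have two (k : 'I_2) : k = 0 \/ k = 1.
  by case: k => [[|[|//]] ?]; [left|right]; apply: val_inj.
have liftE : lift ord0 ord0 = 1 :> 'I_2 by apply: val_inj.
have iN : 'i * Num.conj 'i = 1 :> C by rewrite -normCK normCi expr1n.
split; apply/matrixP => i j; rewrite !mxE !big_ord_recl big_ord0 !mxE addr0 liftE;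
  by case: (two i) => ->; case: (two j) => -> /=;
    rewrite ?Ni ?rmorphN ?mulrNN /= ?conjC0 ?conjC1
      ?iN ?(mulr0, mul0r, mulr1, addr0, add0r).
Qed.

(** The Pauli matrices are unitary and the weights (1 - p) + 3 (p/3) add up to 1. Normalization and
    compatibility of the limit functional rest on this. *)
Lemma depol_unital : \sum_(a : 'I_4) A a *m adjmx (A a) = 1%:M.
Proof.
have [xx yy zz] := sigma_unitary.
rewrite (sum_depol (fun Y => Y *m adjmx Y)) !adjmxZ !conj_realC adjmx1.
rewrite -!scalemxAr -!scalemxAl xx yy zz mulmx1 !scalerA -!expr2.
rewrite sqr_sqrt1p sqr_sqrtp3 -!scalerDl -[RHS]scale1r; congr (_ *: _).
by rewrite rmorphB rmorph1 fmorph_div rmorph_nat; field.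
Qed.

(** Cyclicity of the trace brings [A a] next to its adjoint, where [depol_unital] applies. *)
Lemma depol_trace1 (P Q : 'M[C]_2) :
  \sum_(a : 'I_4) \tr (adjmx (P *m A a) *m (Q *m A a)) = \tr (adjmx P *m Q).
Proof.
rewrite -[in RHS](mulmx1 Q) -depol_unital !mulmx_sumr raddf_sum /=.
by apply: eq_bigr => a _; rewrite adjmxM -mulmxA mxtrace_mulC -!mulmxA.
Qed.

Lemma mpsprod1 (a : 'I_4) : mpsprod A ([ffun=> a] : cfg 1) = A a.
Proof. by rewrite /mpsprod big_ord1 ffunE. Qed.

Lemma depol_trace L (P Q : 'M[C]_2) :
  \sum_(k : cfg L) \tr (adjmx (P *m mpsprod A k) *m (Q *m mpsprod A k)) =
  \tr (adjmx P *m Q).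
Proof.
elim: L P Q => [|L IH] P Q.
  by apply: sum_cfg0 => k; rewrite /mpsprod big_ord0 !mulmx1.
rewrite -addn1 sum_cfgD -IH; apply: eq_bigr => k _; rewrite sum_cfg1.
rewrite -depol_trace1; apply: eq_bigr => a _.
by rewrite mpsprodD mpsprod1 !mulmxA.
Qed.

(** Peeling off the last letter gives one more factor lam and an additional (1 - lam)/2 times a
    trace form, which [depol_trace] shows to be invariant under the remaining letters. *)
Lemma depol_overlap L (P Q : 'M[C]_2) :
  \sum_(k : cfg L) Num.conj (\tr (P *m mpsprod A k)) * \tr (Q *m mpsprod A k) =
  lam ^+ L * (Num.conj (\tr P) * \tr Q) + (1 - lam ^+ L) / 2 * \tr (adjmx P *m Q).
Proof.
elim: L P Q => [|L IH] P Q.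
  rewrite expr0 mul1r subrr mul0r mul0r addr0.
  by apply: sum_cfg0 => k; rewrite /mpsprod big_ord0 !mulmx1.
rewrite -addn1 sum_cfgD.
under eq_bigr => k _.
  rewrite sum_cfg1; under eq_bigr => a _ do rewrite mpsprodD mpsprod1 !mulmxA.
  rewrite depol_overlap1; over.
rewrite big_split -!mulr_sumr /= IH depol_trace addn1 exprS.
by field.
Qed.

Definition limit_form n (X : obs R n) : C :=
  2^-1 * \sum_(i : cfg n) \sum_(j : cfg n)
    mxent X i j * \tr (mpsprod_adj A i *m mpsprod A j).

(** The unnormalized expectation <Psi_n|X|Psi_n>, see [mpv_quad]. *)
Definition mpv_form n (X : obs R n) : C :=
  \sum_(i : cfg n) \sum_(j : cfg n)
    mxent X i j * (Num.conj (\tr (mpsprod A i)) * \tr (mpsprod A j)).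

(** The added sites are summed away by [depol_trace]; hence the value depends only on the local
    observable and not on the number of sites used to represent it. *)
Lemma limit_form_ext n m (X : obs R n) : limit_form (obs_ext m X) = limit_form X.
Proof.
rewrite /limit_form (sum_obs_ext X
  (fun i j => \tr (mpsprod_adj A i *m mpsprod A j))); congr (_ * _).
apply: eq_bigr => i _; apply: eq_bigr => j _; congr (_ * _).
rewrite mpsprod_adjE -(depol_trace m); apply: eq_bigr => k _.
by rewrite mpsprod_adjE !mpsprodD.
Qed.

(** Each row k of X contributes a squared Hilbert-Schmidt norm, which makes positivity visible. *)
Lemma limit_form_adjM n (X : obs R n) :
  limit_form (adjmx X *m X) = 2^-1 * \sum_k
    \tr (adjmx (\sum_j mxent X k j *: mpsprod A j) *m
         (\sum_j mxent X k j *: mpsprod A j)).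
Proof.
congr (_ * _).
transitivity (\sum_(i : cfg n) \sum_(j : cfg n) \sum_(k : cfg n)
    Num.conj (mxent X k i) * mxent X k j *
      \tr (mpsprod_adj A i *m mpsprod A j)).
  apply: eq_bigr => i _; apply: eq_bigr => j _; rewrite mxent_mul mulr_suml.
  by apply: eq_bigr => k _; rewrite mxent_adj.
under eq_bigr do rewrite exchange_big /=.
rewrite exchange_big /=; apply: eq_bigr => k _.
have adj_sum : adjmx (\sum_j mxent X k j *: mpsprod A j) =
    \sum_j Num.conj (mxent X k j) *: mpsprod_adj A j.
  rewrite (big_morph (@adjmx R 2 2) (@adjmxD R 2 2) (id1 := 0)).
    by apply: eq_bigr => j _; rewrite adjmxZ mpsprod_adjE.
  by apply/matrixP => i j; rewrite !mxE rmorph0.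
rewrite adj_sum mulmx_suml raddf_sum; apply: eq_bigr => i _ /=.
rewrite mulmx_sumr raddf_sum; apply: eq_bigr => j _ /=.
by rewrite -scalemxAl -scalemxAr scalerA mxtraceZ.
Qed.

Lemma limit_form_linear n : scalar (@limit_form n).
Proof.
move=> a X Y; rewrite /limit_form mulrCA -mulrDr; congr (_ * _).
rewrite mulr_sumr -big_split; apply: eq_bigr => i _ /=.
rewrite mulr_sumr -big_split; apply: eq_bigr => j _ /=.
by rewrite /mxent !mxE mulrDl mulrA.
Qed.

Lemma limit_form_state n : mx_state (@limit_form n).
Proof.
split; first exact: limit_form_linear.
  move=> X; rewrite limit_form_adjM mulr_ge0 ?invr_ge0 ?ler0n //.
  by apply: sumr_ge0 => k _; exact: mxtrace_adjM_ge0.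
(* For the identity observable only i = j remains, and [depol_trace] at P = Q = 1 gives Tr 1 = 2,
   cancelled by the prefactor. *)
rewrite /limit_form; transitivity (2^-1 * \tr (adjmx 1%:M *m 1%:M : 'M[C]_2)).
  rewrite -(depol_trace n); congr (_ * _); apply: eq_bigr => i _.
  rewrite (bigD1 i) //= big1 => [|j /negPf ji]; last first.
    by rewrite mxent1 eq_sym ji mul0r.
  by rewrite mxent1 eqxx addr0 mul1r mpsprod_adjE !mul1mx.
by rewrite adjmx1 mulmx1 mxtrace1 mulVf // pnatr_eq0.
Qed.

End Depolarizing.

(** * Closed form of the finite states and positivity of their normalization *)

Section LimitState.
Variables (R : realType) (p : R).
Hypothesis hp : 0 <= p <= 1.
Local Notation C := R[i].
Local Notation A := (depolA p).
Local Notation lam := (depol_eig p)%:C.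

Lemma mpv_quad n (Y : obs R n) :
  (adjmx (mpv A n) *m Y *m mpv A n) 0 0 = mpv_form p Y.
Proof.
rewrite mxE sum_enum_val.
under eq_bigr do rewrite mxE sum_enum_val mulr_suml.
rewrite exchange_big; apply: eq_bigr => i _; apply: eq_bigr => j _ /=.
by rewrite adjmxE !mxE !enum_rankK mulrA; congr (_ * _); exact: mulrC.
Qed.

(** The added sites are summed by [depol_overlap]; the 1/2 in its trace term is the prefactor of
    [limit_form]. *)
Lemma mpv_form_ext n m (X : obs R n) :
  mpv_form p (obs_ext m X) = lam ^+ m * mpv_form p X + (1 - lam ^+ m) * limit_form p X.
Proof.
rewrite /mpv_form (sum_obs_ext X
  (fun i j => Num.conj (\tr (mpsprod A i)) * \tr (mpsprod A j))).
rewrite /limit_form !mulrA !mulr_sumr -big_split; apply: eq_bigr => i _ /=.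
rewrite !mulr_sumr -big_split; apply: eq_bigr => j _ /=.
under eq_bigr do rewrite !mpsprodD.
by rewrite depol_overlap // -mpsprod_adjE; field.
Qed.

(** The overlap at P = Q = 1 is 4 lam^n + (1 - lam^n). *)
Lemma mpv_form1 n : mpv_form p (1%:M : obs R n) = 1 + 3 * lam ^+ n.
Proof.
transitivity (\sum_(k : cfg n) Num.conj (\tr (1%:M *m mpsprod A k)) *
    \tr (1%:M *m mpsprod A k)).
  apply: eq_bigr => i _.
  rewrite (bigD1 i) //= big1 => [|j /negPf ji]; last first.
    by rewrite mxent1 eq_sym ji mul0r.
  by rewrite mxent1 eqxx addr0 mul1r !mul1mx.
by rewrite depol_overlap // adjmx1 mulmx1 mxtrace1 rmorph_nat; field.
Qed.

Lemma mpv_norm n : (adjmx (mpv A n) *m mpv A n) 0 0 = 1 + 3 * lam ^+ n.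
Proof. by rewrite -[adjmx _]mulmx1 mpv_quad mpv_form1. Qed.

Lemma mpstateE n (X : obs R n) :
  mpstate A X = (lam * mpv_form p X + (1 - lam) * limit_form p X) /
    (1 + 3 * lam ^+ n.+1).
Proof.
by rewrite /mpstate mpv_quad mpv_norm mpv_form_ext expr1 addn1.
Qed.

(** The m added sites and the extra site inside [mpstate] together give the exponent m + 1. In the
    denominator the power is split so that only [lam ^+ m] varies with m. *)
Lemma mpstate_extE n m (X : obs R n) :
  mpstate A (obs_ext m X) =
  (lam ^+ m.+1 * mpv_form p X + (1 - lam ^+ m.+1) * limit_form p X) /
    (1 + 3 * (lam ^+ n.+1 * lam ^+ m)).
Proof.
rewrite mpstateE mpv_form_ext limit_form_ext // -exprD addSn; congr (_ / _).
by rewrite exprS; ring.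
Qed.

(** The eigenvalue lies in [-1/3, 1]. If it is negative, its powers from the second on are at least
    -1/9, so the value is at least 2/3. At n = 1 and p = 1 the value would be 0. *)
Lemma depol_eig_norm1 n : (2 <= n)%N -> 0 < 1 + 3 * depol_eig p ^+ n.
Proof.
case: n => [|[|n]] // _; rewrite /depol_eig; set l := 1 - _.
have [l_ge l_le] : - 3^-1 <= l /\ l <= 1.
  by case/andP: hp => p0 p1; rewrite /l; split; lra.
have [l0|l0] := lerP 0 l; first by
  rewrite addrC ltr_wpDl ?ltr01 // mulr_ge0 ?exprn_ge0 ?ler0n.
have l1 : `|l| <= 3^-1 by rewrite ltr0_norm // lerNl.
have : `|l ^+ n.+2| <= 9^-1.
  have -> : 9^-1 = 3^-1 ^+ 2 :> R by rewrite exprVn -natrX.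
  rewrite normrX -addn2 exprD -[leRHS]mul1r ler_pM ?exprn_ge0 //.
    by rewrite exprn_ile1 // (le_trans l1) // invf_le1 // ler1n.
  by rewrite lerXn2r // nnegrE // invr_ge0.
by rewrite ler_norml => /andP[h _]; lra.
Qed.

Lemma mpstate_state n : (1 <= n)%N -> mx_state (mpstate A (n := n)).
Proof.
move=> n1.
(* The vector lives on n + 1 >= 2 sites, so its squared norm is positive. *)
have nz : 0 < 1 + 3 * lam ^+ (n + 1).
  have : (2 <= n + 1)%N by rewrite addn1.
  move/depol_eig_norm1; rewrite -ltcR.
  by move: (depol_eig p) => l; rewrite rmorphD rmorphM rmorphXn rmorph1 rmorph_nat.
split.
- move=> a X Y; rewrite /mpstate obs_ext_linear mulmxDr mulmxDl mxE.
  by rewrite -scalemxAr -scalemxAl mxE mulrDl mulrA.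
- move=> X; rewrite /mpstate mpv_norm divr_ge0 ?(ltW nz) //.
  rewrite obs_extM obs_ext_adj !mulmxA -adjmxM -mulmxA.
  (* The quadratic form at X^* X is the squared norm of the vector (X tensor 1) Psi, a 1 by 1
     trace. *)
  by have := mxtrace_adjM_ge0 (obs_ext 1 X *m mpv A (n + 1)); rewrite /mxtrace big_ord1.
- by rewrite /mpstate obs_ext1 mulmx1 divff // mpv_norm gt_eqF.
Qed.

End LimitState.

(** * Convergence on local observables *)

Section Convergence.
Variables (R : realType).
Local Notation C := R[i].

(** At p = 0 all products are scalar: conj(Tr c) Tr d is 4 conj(c) d, while half the trace of
    conj(c) d is conj(c) d. *)
Lemma mpv_form0 n (X : obs R n) : mpv_form 0 X = 4 * limit_form 0 X.
Proof.
have A0 (a : 'I_4) : exists c : C, depolA (0 : R) a = c%:M.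
  rewrite /depolA mul0r sqrtr0 subr0 sqrtr1.
  by case: (val a) => [|[|[|k]]]; [exists 1|exists 0..];
    rewrite ?scale1r ?scale0r ?raddf0.
have As (i : cfg n) : exists c : C, mpsprod (depolA 0) i = c%:M.
  rewrite /mpsprod; elim/big_ind: _ => [|_ _ [c ->] [d ->]|k _]; last exact: A0.
    by exists 1.
  by exists (c * d); rewrite [RHS]scalar_mxM.
rewrite /limit_form mulrA mulr_sumr; apply: eq_bigr => i _.
rewrite mulr_sumr; apply: eq_bigr => j _.
have [c ci] := As i; have [d dj] := As j.
rewrite mpsprod_adjE ci dj /adjmx map_scalar_mx tr_scalar_mx -scalar_mxM.
by rewrite !mxtrace_scalar !mulr2n rmorphD /=; field.
Qed.

(** A positive element of [R[i]] is real, so the real statement can be applied to its real part. *)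
Lemma cvg_expr_real (l : R) : `|l| < 1 ->
  (l%:C ^+ m : C^o) @[m --> \oo] --> (0 : C^o).
Proof.
move=> l1; apply/cvgr0Pnorm_lt => e e0.
have eE : e = (complex.Re e)%:C by rewrite RRe_real // gtr0_real.
have e0' : 0 < complex.Re e by rewrite -ltcR -eE.
have := cvg_expr l1; move/cvgr0Pnorm_lt => /(_ _ e0').
apply: filterS => m lm.
by rewrite eE -rmorphXn normc_def /= expr0n addr0 sqrtr_sqr ltcR.
Qed.

Lemma mpstate_cvg (p : R) : 0 <= p <= 1 -> forall n (X : obs R n),
  (mpstate (depolA p) (obs_ext m X) : C^o) @[m --> \oo] --> (limit_form p X : C^o).
Proof.
move=> hp n X.
under eq_fun do rewrite mpstate_extE //.
set l := depol_eig p.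
(* At p = 0 the eigenvalue is 1 and nothing decays, but the quotient is constant by [mpv_form0]; for
   p > 0 the eigenvalue lies in [-1/3, 1). *)
have [p0|pn0] := eqVneq p 0.
  have l1 : l = 1 by rewrite /l /depol_eig p0 mulr0 mul0r subr0.
  apply: cvg_near_cst; apply: nearW => m.
  by rewrite l1 rmorph1 !expr1n mulr1 mul1r p0 mpv_form0; field.
have l1 : `|l| < 1.
  rewrite ltr_norml /l /depol_eig; case/andP: hp => p_ge0 p_le1.
  have p_gt0 : 0 < p by rewrite lt_def pn0.
  by apply/andP; split; lra.
have cl := cvg_expr_real l1.
have clS : (l%:C ^+ m.+1 : C^o) @[m --> \oo] --> (0 : C^o).
  by rewrite (cvg_shiftS (fun m => l%:C ^+ m : C^o)).
(* The limit is written in the shape of the sequence so that the limit laws apply term by term. *)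
suff : ((l%:C ^+ m.+1 * mpv_form p X + (1 - l%:C ^+ m.+1) * limit_form p X) /
      (1 + 3 * (l%:C ^+ n.+1 * l%:C ^+ m)) : C^o) @[m --> \oo] -->
    ((0 * mpv_form p X + (1 - 0) * limit_form p X) /
      (1 + 3 * (l%:C ^+ n.+1 * 0)) : C^o).
  by rewrite mul0r add0r subr0 mul1r !mulr0 addr0 divr1.
apply: cvgM; last first.
  apply: cvgV; first by rewrite !mulr0 addr0 oner_neq0.
  apply: cvgD; first exact: cvg_cst.
  apply: cvgM; first exact: cvg_cst.
  apply: cvgM; first exact: cvg_cst.
  exact: cl.
apply: cvgD.
  apply: cvgM; first exact: clS.
  exact: cvg_cst.
apply: cvgM; last exact: cvg_cst.
apply: cvgB; first exact: cvg_cst.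
exact: clS.
Qed.

End Convergence.

(** * Matrix states are contractive for the norm of an ambient C*-algebra *)

Section MatrixStateBound.
Variables (R : realType).
Local Notation C := R[i].

Section State.
Variables (d : nat) (f : 'M[C]_d -> C).
Hypothesis hf : mx_state f.

Lemma mx_stateD X Y : f (X + Y) = f X + f Y.
Proof. by case: hf => fl _ _; rewrite -[X]scale1r fl mul1r scale1r. Qed.

Lemma mx_state0 : f 0 = 0.
Proof. by apply: (addrI (f 0)); rewrite -mx_stateD !addr0. Qed.

Lemma mx_stateZ a X : f (a *: X) = a * f X.
Proof. by case: hf => fl _ _; rewrite -[a *: X]addr0 fl mx_state0 addr0. Qed.

Lemma mx_state_sum (I : finType) (F : I -> 'M[C]_d) :
  f (\sum_i F i) = \sum_i f (F i).
Proof. exact: (big_morph f mx_stateD mx_state0). Qed.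

(** Positivity at X + c 1, expanded. Choices of c yield hermiticity and the Cauchy-Schwarz
    inequality. *)
Lemma mx_state_shift_ge0 X c :
  0 <= f (adjmx X *m X) + c * f (adjmx X) + Num.conj c * f X + Num.conj c * c.
Proof.
case: hf => _ pos one; have := pos (X + c *: 1%:M).
rewrite adjmxD adjmxZ adjmx1 mulmxDl !mulmxDr -!scalemxAl -!scalemxAr !mulmx1 !mul1mx.
by rewrite !mx_stateD !mx_stateZ one mulr1 addrA.
Qed.

(** Nonnegative elements are real, so the terms linear in c and conj(c) have a real sum for every c;
    c = 1 and c = i determine the adjoint value. *)
Lemma mx_state_adj X : f (adjmx X) = Num.conj (f X).
Proof.
have realX c : Num.conj (c * f (adjmx X) + Num.conj c * f X) =
    c * f (adjmx X) + Num.conj c * f X.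
  have s0 : f (adjmx X *m X) \is Num.real by case: hf => _ pos _; rewrite ger0_real.
  have c0 : Num.conj c * c \is Num.real by rewrite mulrC ger0_real // mul_conjC_ge0.
  apply: conj_Creal.
  rewrite (_ : _ + _ = (f (adjmx X *m X) + c * f (adjmx X) + Num.conj c * f X +
      Num.conj c * c) - f (adjmx X *m X) - Num.conj c * c); last by ring.
  by rewrite !rpredB // ger0_real // mx_state_shift_ge0.
have := realX 1; have := realX 'i%R.
rewrite !rmorphD !rmorphM /= !conjCK conjCi !conjC1 !mul1r => hi h1.
have {}hi : Num.conj (f (adjmx X)) - Num.conj (f X) = f X - f (adjmx X).
  apply: (@mulfI _ ('i%R : C)); first exact: neq0Ci.
  transitivity (- (- 'i%R * Num.conj (f (adjmx X)) + 'i%R * Num.conj (f X))).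
    by ring.
  by rewrite hi; ring.
rewrite -[LHS]conjCK; congr (Num.conj _).
apply: (@mulfI _ (2 : C)); first by rewrite pnatr_eq0.
transitivity (Num.conj (f (adjmx X)) + Num.conj (f X) +
  (Num.conj (f (adjmx X)) - Num.conj (f X))); first by ring.
by rewrite hi h1; ring.
Qed.

(** The choice c = - f X minimizes the shifted form and leaves f (X^* X) - |f X|^2. *)
Lemma mx_state_CS X : `|f X| ^+ 2 <= `|f (adjmx X *m X)|.
Proof.
have [_ pos _] := hf.
rewrite (ger0_norm (pos X)) -subr_ge0.
have := mx_state_shift_ge0 X (- f X).
by rewrite mx_state_adj normCK rmorphN; congr (0 <= _); ring.
Qed.

End State.

(** If b < a with b positive, the powers of a/b would outgrow c by Bernoulli's inequality. *)
Lemma le_of_exp2_le (a b c : R) : 0 <= a -> 0 <= b ->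
  (forall k, a ^+ (2 ^ k) <= c * b ^+ (2 ^ k)) -> a <= b.
Proof.
move=> a0 b0 hk; rewrite leNgt; apply/negP => ba.
have [b_eq0|b_neq0] := eqVneq b 0.
  by have := hk 0; rewrite b_eq0 expn0 !expr1 mulr0 leNgt (le_lt_trans b0 ba).
have bp : 0 < b by rewrite lt_def b_neq0.
have bernoulli (e : R) n : 0 <= e -> 1 + e *+ n <= (1 + e) ^+ n.
  move=> e0; elim: n => [|n IH]; first by rewrite mulr0n addr0 expr0.
  rewrite exprS (le_trans _ (ler_wpM2l _ IH)) ?addr_ge0 //.
  by rewrite mulrDl mul1r mulrDr mulr1 mulrSr !addrA lerDl mulr_ge0 ?mulrn_wge0.
have e0 : 0 < a / b - 1 by rewrite subr_gt0 ltr_pdivlMr // mul1r.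
(* Bernoulli gives 2^k times a/b - 1; the weaker factor k already contradicts the archimedean
   property. *)
have bnd k : (a / b - 1) *+ k <= c.
  apply: (@le_trans _ _ ((a / b) ^+ (2 ^ k))).
    have := bernoulli _ (2 ^ k)%N (ltW e0); rewrite [1 + (_ - 1)]addrC subrK.
    apply: le_trans; rewrite -[leLHS]add0r lerD // ler_wpMn2l ?(ltW e0) //.
    exact: ltnW (ltn_expl k (ltnSn 1)).
  by rewrite expr_div_n ler_pdivrMr ?exprn_gt0.
have := bnd (Num.bound (c / (a / b - 1))).
have c0 : 0 <= c by rewrite -(mulr0n (a / b - 1)) bnd.
rewrite leNgt -mulr_natl -ltr_pdivrMr // archi_boundP //.
by rewrite divr_ge0 // ltW.
Qed.

Lemma le_of_exp2_leC (a b c : C) : 0 <= a -> 0 <= b -> 0 <= c ->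
  (forall k, a ^+ (2 ^ k) <= c * b ^+ (2 ^ k)) -> a <= b.
Proof.
have realE (x : C) : 0 <= x -> x = (complex.Re x)%:C.
  by move=> x0; rewrite RRe_real // ger0_real.
move=> a0 b0 c0; move: (a0) (b0); rewrite (realE a) // (realE b) // (realE c) //.
rewrite !lecR => a0' b0' hk; apply: (le_of_exp2_le (c := complex.Re c)) => // k.
by have := hk k; rewrite -!rmorphXn -rmorphM lecR.
Qed.

Section Bound.
Variables (B : cstarAlgebra R) (d : nat) (f : 'M[C]_d -> C) (j : 'M[C]_d -> B).
Hypothesis hf : mx_state f.
Hypothesis j_linear : linear j.
Hypothesis j_mul : forall X Y, j (X *m Y) = cs_mul (j X) (j Y).
Hypothesis j_star : forall X, j (adjmx X) = cs_star (j X).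
Hypothesis j_inj : injective j.

Lemma embedding0 : j 0 = 0.
Proof.
apply: (addrI (j 0)).
by rewrite -{1}[j 0]scale1r -j_linear scaler0 !addr0.
Qed.

Lemma embeddingZ a X : j (a *: X) = a *: j X.
Proof. by rewrite -[a *: X]addr0 j_linear embedding0 addr0. Qed.

(* Y_ab E_ab = E_aa Y E_bb bounds each entry of Y by the norm of j Y. *)
Lemma mx_state_bounded : exists2 K : C, 0 <= K & forall Y, `|f Y| <= K * `|j Y|.
Proof.
pose E (a b : 'I_d) : 'M[C]_d := delta_mx a b.
have jE a b : 0 < `|j (E a b)|.
  rewrite normr_gt0; apply/eqP; rewrite -embedding0 => /j_inj/matrixP/(_ a b)/eqP.
  by rewrite !mxE !eqxx oner_eq0.
pose K (a b : 'I_d) : C := `|f (E a b)| * (`|j (E a a)| * `|j (E b b)| / `|j (E a b)|).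
exists (\sum_a \sum_b K a b).
  apply: sumr_ge0 => a _; apply: sumr_ge0 => b _.
  by rewrite !(mulr_ge0, invr_ge0).
move=> Y; rewrite {1}[Y]matrix_sum_delta mx_state_sum //.
rewrite mulr_suml (le_trans (ler_norm_sum _ _ _)) //; apply: ler_sum => a _.
rewrite mx_state_sum // mulr_suml (le_trans (ler_norm_sum _ _ _)) //.
apply: ler_sum => b _; rewrite mx_stateZ // normrM [leLHS]mulrC /K -[leRHS]mulrA.
rewrite ler_wpM2l // mulrAC ler_pdivlMr //.
rewrite -normrZ -embeddingZ.
have -> : Y a b *: E a b = E a a *m Y *m E b b.
  apply/matrixP => i k; rewrite !mxE (bigD1 b) //= big1 => [|l /negPf lb]; last first.
    by rewrite !mxE lb andFb mulr0.
  rewrite !mxE (bigD1 a) //= big1 => [|l /negPf la]; last first.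
    by rewrite !mxE la andbF mul0r.
  by rewrite !mxE !eqxx !addr0 andbT /=; case: eqP; case: eqP;
    rewrite ?(mulr0, mulr1, mul0r, mul1r).
rewrite !j_mul (le_trans (cs_normM _ _)) // mulrAC ler_wpM2r //.
exact: cs_normM.
Qed.

Lemma mx_state_contractive X : `|f X| <= `|j X|.
Proof.
have [K K0 fK] := mx_state_bounded.
pose Y k := iter k (fun Z => adjmx Z *m Z) X.
have fY k : `|f X| ^+ (2 ^ k) <= `|f (Y k)|.
  elim: k => [|k IH]; first by rewrite expn0 expr1.
  rewrite expnSr exprM (le_trans _ (mx_state_CS hf _)) //.
  by rewrite lerXn2r // nnegrE ?exprn_ge0.
(* The C*-identity squares the norm at each iteration. *)
have jY k : `|j (Y k)| = `|j X| ^+ (2 ^ k).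
  elim: k => [|k IH]; first by rewrite expn0 expr1.
  by rewrite expnSr exprM -IH -cs_normC -j_star -j_mul.
apply: (le_of_exp2_leC (c := K)) => // k.
by rewrite -jY (le_trans (fY k)).
Qed.

End Bound.
End MatrixStateBound.

(** * Extending a contractive functional from a dense subspace *)

Section DenseExtension.
Variables (R : realType) (V : normedModType R[i]).
Local Notation C := R[i].

Lemma eq0_of_norm_le (K z : C) : 0 <= K ->
  (forall e, 0 < e -> `|z| <= K * e) -> z = 0.
Proof.
move=> K0 zK; case: (eqVneq z 0) => // z0.
have K_lt : K < 2 * (K + 1).
  by rewrite mulrDr mulr1 mulr_natl mulr2n -addrA ltrDl ltr_wpDl ?ltr0n.
have c0 : 0 < 2 * (K + 1) by rewrite (le_lt_trans K0).
(* For nonzero z this choice would force 2 (K + 1) <= K; the summand 1 keeps the divisor positive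
   when K = 0. *)
have := zK (`|z| / (2 * (K + 1))); rewrite divr_gt0 ?normr_gt0 // => /(_ isT).
rewrite mulrA ler_pdivlMr // mulrC ler_pM2r ?normr_gt0 // => h.
by have := le_lt_trans h K_lt; rewrite ltxx.
Qed.

(** A real-valued norm, because infima are taken in [R] while the norm of [V] has values in
    [R[i]]. *)
Definition nrm (x : V) : R := complex.Re `|x|.

Lemma nrmE x : (nrm x)%:C = `|x|.
Proof. by rewrite RRe_real // normr_real. Qed.

(* McShane's formula u x = inf (c + |x - y|) over the pairs (y, c). *)
Lemma lipschitz_extension (g : V -> R -> Prop) :
  (exists y c, g y c) ->
  (forall y c y' c', g y c -> g y' c' -> c - c' <= nrm (y - y')) ->
  exists u : V -> R, forall x y c, g y c -> `|u x - c| <= nrm (x - y).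
Proof.
move=> [y0 [c0 g0]] glip.
pose S x := [set r : R | exists y c, g y c /\ r = c + nrm (x - y)].
have nrm_tri x y z : nrm (x - z) <= nrm (x - y) + nrm (y - z).
  by rewrite -lecR rmorphD /= !nrmE ler_distD.
have nrmC x y : nrm (x - y) = nrm (y - x) by rewrite /nrm distrC.
have Slb x y c : g y c -> lbound (S x) (c - nrm (x - y)).
  move=> gy _ [y' [c' [gy' ->]]]; have := glip _ _ _ _ gy gy'.
  have := nrm_tri y x y'; rewrite (nrmC y x); lra.
have Sne x : S x !=set0 by exists (c0 + nrm (x - y0)); exists y0, c0.
exists (fun x => inf (S x)) => x y c gy; rewrite ler_norml; apply/andP; split.
  rewrite lerBrDl; apply: lb_le_inf => //; exact: Slb.
rewrite lerBlDl; apply: ge_inf; last by exists y, c.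
by exists (c - nrm (x - y)); exact: Slb.
Qed.

Lemma norm_le_ReIm (z : C) : `|z| <= `|complex.Re z|%:C + `|complex.Im z|%:C.
Proof.
rewrite [z in leLHS]complexE (le_trans (ler_normD _ _)) // normrM.
have norm_real (r : R) : `|r%:C| = `|r|%:C.
  by rewrite normc_def /= expr0n addr0 sqrtr_sqr.
by rewrite !norm_real [`|'i|]normCi mul1r.
Qed.

Variable G : V -> C -> Prop.
Hypothesis G_linear : forall a x c y d, G x c -> G y d -> G (a *: x + y) (a * c + d).
Hypothesis G_contractive : forall x c, G x c -> `|c| <= `|x|.
Hypothesis G_dense : forall x (e : C), 0 < e -> exists y c, G y c /\ `|x - y| < e.

(** [G] is the graph of a linear contraction with dense domain. Real and imaginary parts are
    extended separately with constant 1, whence the factor 2. *)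
Lemma dense_lipschitz_extension :
  exists phi : V -> C, forall x y c, G y c -> `|phi x - c| <= 2 * `|x - y|.
Proof.
have [y0 [c0 [G0 _]]] := G_dense 0 ltr01.
have Gsub y c y' c' : G y c -> G y' c' -> `|c - c'| <= `|y - y'|.
  move=> Gy Gy'; have := G_linear (-1) Gy' Gy.
  by rewrite scaleN1r mulN1r ![- _ + _]addrC => /G_contractive.
have ext (h : C -> R) : (forall z w, h (z - w) = h z - h w) ->
    (forall z, (h z)%:C <= `|z|) ->
    exists u : V -> R, forall x y c, G y c -> `|u x - h c| <= nrm (x - y).
  move=> hB h_le.
  have [|y r y' r' [c Gy ->] [c' Gy' ->]|u uP] :=
      lipschitz_extension (g := fun y r => exists2 c, G y c & r = h c).
  - by exists y0, (h c0), c0.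
  - by rewrite -hB -lecR nrmE (le_trans (h_le _)) // Gsub.
  by exists u => x y c Gy; apply: uP; exists c.
have [z w|z|u uP] := ext (@complex.Re R); first by case: z w => [? ?] [? ?].
  by rewrite (le_trans _ (normc_ge_Re z)) // lecR ler_norm.
have [z w|z|v vP] := ext (@complex.Im R); first by case: z w => [? ?] [? ?].
  rewrite normc_def lecR (le_trans (ler_norm _)) // -sqrtr_sqr.
  by rewrite ler_sqrt ?addr_ge0 ?sqr_ge0 // lerDr sqr_ge0.
exists (fun x => u x +i* v x) => x y c Gy.
rewrite (le_trans (norm_le_ReIm _)) // mulr_natl mulr2n -nrmE.
rewrite lerD // lecR; case: c Gy => a b Gy /=.
  exact: (uP x y _ Gy).
exact: (vP x y _ Gy).
Qed.

(** Linearity holds on [G], and x, y are approximated there within e. The linearity defect is then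
    at most 2 (|a| + 1) e from the combination plus 2 |a| e + 2 e from the two points. *)
Lemma dense_linear_extension :
  exists phi : V -> C, [/\ scalar phi, forall y c, G y c -> phi y = c
    & forall x y c, G y c -> `|phi x - c| <= 2 * `|x - y|].
Proof.
have [phi phiP] := dense_lipschitz_extension.
exists phi; split=> //; last first.
  move=> y c Gy; apply/eqP; rewrite -subr_eq0 -normr_le0.
  by have := phiP y y c Gy; rewrite subrr normr0 mulr0.
move=> a x y; apply/eqP; rewrite -subr_eq0; apply/eqP.
apply: (@eq0_of_norm_le (4 * (`|a| + 1))); first by rewrite mulr_ge0 ?addr_ge0.
move=> e e0; have [x' [c [Gx xx']]] := G_dense x e0.
have [y' [d [Gy yy']]] := G_dense y e0.
rewrite (_ : _ - _ = (phi (a *: x + y) - (a * c + d)) +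
    (a * (c - phi x) + (d - phi y))); last by ring.
have xy : `|a *: x + y - (a *: x' + y')| <= (`|a| + 1) * e.
  rewrite opprD addrACA -scalerBr (le_trans (ler_normD _ _)) // normrZ mulrDl mul1r.
  by rewrite lerD ?ler_wpM2l // ltW.
rewrite (_ : 4 * _ * e = 2 * ((`|a| + 1) * e) + (`|a| * (2 * e) + 2 * e)); last by ring.
rewrite (le_trans (ler_normD _ _)) // lerD //.
  by rewrite (le_trans (phiP _ _ _ (G_linear a Gx Gy))) // ler_wpM2l.
rewrite (le_trans (ler_normD _ _)) // lerD //.
  rewrite normrM ler_wpM2l // distrC (le_trans (phiP _ _ _ Gx)) // ler_wpM2l //.
  exact: ltW.
by rewrite distrC (le_trans (phiP _ _ _ Gy)) // ler_wpM2l // ltW.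
Qed.

End DenseExtension.

(** * Extending a state from a dense *-subalgebra *)

Section CstarExtension.
Variables (R : realType) (B : cstarAlgebra R).
Local Notation C := R[i].

(** The C*-identity bounds the square of the norm of y by the product of the norms of y^* and y;
    dividing, and repeating with y^* in place of y, gives both inequalities. *)
Lemma cs_norm_star (x : B) : `|cs_star x| = `|x|.
Proof.
have le_star y : `|y| <= `|cs_star y| :> C.
  have [->|y0] := eqVneq y 0; first by rewrite normr0.
  by rewrite -(@ler_pM2r _ `|y|) ?normr_gt0 // -expr2 -cs_normC cs_normM.
by apply/le_anti; rewrite le_star -{2}(cs_starK x) le_star.
Qed.

Variable G : B -> C -> Prop.
Hypothesis G_linear : forall a x c y d, G x c -> G y d -> G (a *: x + y) (a * c + d).
Hypothesis G_contractive : forall x c, G x c -> `|c| <= `|x|.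
Hypothesis G_dense : forall x (e : C), 0 < e -> exists y c, G y c /\ `|x - y| < e.
Hypothesis G_pos : forall y c, G y c ->
  exists2 d, G (cs_mul (cs_star y) y) d & 0 <= d.
Hypothesis G_one : G (cs_one B) 1.

Lemma cs_mulN (x y : B) : cs_mul x (- y) = - cs_mul x y.
Proof. by rewrite -scaleN1r cs_mulZr scaleN1r. Qed.

Lemma cs_starN (x : B) : cs_star (- x) = - cs_star x.
Proof. by rewrite -scaleN1r cs_starZ rmorphN rmorph1 scaleN1r. Qed.

Lemma state_extension :
  exists2 phi : B -> C, cstar_state phi & forall y c, G y c -> phi y = c.
Proof.
have [phi [phi_lin phiG phi_lip]] :=
  dense_linear_extension G_linear G_contractive G_dense.
exists phi => //; split=> //; last exact: phiG.
move=> x; set z := phi _.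
(* Positivity is obtained as z = |z|: z is close to values d >= 0 of the functional at y^* y. The
   distance from z to d is counted twice, once for z and once for |z|. *)
suff -> : z = `|z| by [].
apply/eqP; rewrite -subr_eq0; apply/eqP.
apply: (@eq0_of_norm_le _ (4 * (`|x| + (`|x| + 1)))).
  by rewrite mulr_ge0 ?addr_ge0.
move=> e e0.
(* Below both e and 1: the first controls the error, the second gives the bound |x| + 1 on the norm
   of y. *)
pose e1 : C := e / (1 + e).
have e1p : 0 < 1 + e by rewrite addr_gt0.
have e1_gt0 : 0 < e1 by rewrite divr_gt0.
have e1_le : e1 <= e by rewrite ler_pdivrMr // ler_peMr ?lerDl ?(ltW e0).
have e1_le1 : e1 <= 1 by rewrite ler_pdivrMr // mul1r lerDr.
have [y [c [Gy xy]]] := G_dense x e1_gt0.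
have [d Gd d0] := G_pos Gy.
have y_le : `|y| <= `|x| + 1.
  rewrite -[y](subrK x) addrC (le_trans (ler_normD _ _)) // lerD2l distrC.
  exact: le_trans (ltW xy) e1_le1.
have zd : `|z - d| <= 2 * ((`|x| + (`|x| + 1)) * e).
  rewrite (le_trans (phi_lip _ _ _ Gd)) // ler_wpM2l //.
  rewrite (_ : _ - _ = cs_mul (cs_star x) (x - y) + cs_mul (cs_star (x - y)) y).
    rewrite (le_trans (ler_normD _ _)) // mulrDl.
    have xe : `|x - y| <= e by apply: le_trans (ltW xy) e1_le.
    rewrite lerD // (le_trans (cs_normM _ _)) // cs_norm_star.
      by rewrite ler_wpM2l.
    by rewrite mulrC ler_pM.
  by rewrite cs_mulDr cs_mulN cs_starD cs_starN cs_mulDl -scaleN1r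
    -cs_mulZl scaleN1r addrA subrK.
rewrite (_ : 4 * _ * e = 2 * ((`|x| + (`|x| + 1)) * e) + 2 * ((`|x| + (`|x| + 1)) * e));
  last by ring.
rewrite -[z - _](subrKA d) (le_trans (ler_normD _ _)) // lerD //.
by rewrite -{1}(ger0_norm d0) (le_trans (ler_dist_dist _ _)) // distrC.
Qed.

End CstarExtension.

(** * The limit state on the quasilocal algebra *)

Section LocalObservables.
Variables (R : realType) (p : R) (B : cstarAlgebra R).
Variable iota : forall n, obs R n -> B.
Hypothesis hp : 0 <= p <= 1.
Hypothesis hB : quasilocal iota.
Local Notation C := R[i].

(** Lets two observables on different numbers of sites be added at a common level. *)
Lemma embed_level n m (X : obs R n) : (n <= m)%N ->
  exists2 Y : obs R m, iota Y = iota X & limit_form p Y = limit_form p X.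
Proof.
move/subnKC => <-; elim: (m - n)%N => [|k [Y iY fY]]; first by rewrite addn0; exists X.
rewrite addnS -addn1; exists (obs_ext 1 Y); first by rewrite (ql_ext hB).
by rewrite limit_form_ext.
Qed.

(** A graph and not a function, because an element of [B] may have representatives at many
    levels. *)
Definition local_graph (x : B) (c : C) : Prop :=
  exists n (X : obs R n), x = iota X /\ c = limit_form p X.

Lemma local_state : exists2 phi : B -> C, cstar_state phi &
  forall n (X : obs R n), phi (iota X) = limit_form p X.
Proof.
have [|||||phi phi_state phiG] := @state_extension R B local_graph.
- move=> a x c y d [n [X [-> ->]]] [m [Y [-> ->]]].
  have [X' <- <-] := embed_level X (leq_maxl n m).
  have [Y' <- <-] := embed_level Y (leq_maxr n m).
  exists (maxn n m), (a *: X' + Y'); split; first by rewrite (ql_linear hB).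
  by rewrite limit_form_linear.
- move=> x c [n [X [-> ->]]].
  apply: (mx_state_contractive (limit_form_state hp n)).
  + exact: ql_linear hB n.
  + exact: ql_mul hB n.
  + exact: ql_star hB n.
  + exact: ql_inj hB n.
- move=> x e e0.
  have : closure (\bigcup_n range (@iota n)) x by rewrite (ql_dense hB).
  move/(_ _ (nbhsx_ballx x e e0)) => [y [[n _ [X _ <-]] xy]].
  exists (iota X), (limit_form p X); split; first by exists n, X.
  by move: xy; rewrite -ball_normE.
- move=> y c [n [X [-> _]]]; exists (limit_form p (adjmx X *m X)).
    by exists n, (adjmx X *m X); rewrite (ql_mul hB) (ql_star hB).
  by case: (limit_form_state hp n).
(* The unit of [B] is represented on zero sites. *)
- exists 0, 1%:M; rewrite (ql_one hB); split=> //.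
  by case: (limit_form_state hp 0).
by exists phi => // n X; apply: phiG; exists n, X.
Qed.

End LocalObservables.

Theorem theorem6p1 (R : realType) (p : R) (hp : 0 <= p <= 1)
    (B : cstarAlgebra R) (iota : forall n, obs R n -> B)
    (hB : quasilocal iota) :
  (forall n, (1 <= n)%N -> mx_state (mpstate (depolA p) (n := n))) /\
  exists phi : B -> R[i],
    [/\ cstar_state phi,
        (forall (N : nat) (X : obs R N),
           (mpstate (depolA p) (obs_ext m X) : R[i]^o) @[m --> \oo] -->
             (phi (iota N X) : R[i]^o))
      & forall (N : nat) (X : obs R N),
          phi (iota N X) =
          2^-1 * \sum_(i : cfg N) \sum_(j : cfg N)
                   mxent X i j *
                   \tr (mpsprod_adj (depolA p) i *m mpsprod (depolA p) j)].
Proof.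
split; first by move=> n; exact: mpstate_state.
have [phi phi_state phiE] := local_state hp hB.
exists phi; split=> [//|N X|N X]; last exact: phiE.
by rewrite phiE; exact: mpstate_cvg.
Qed.
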